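(* Let $R$ be an almost Dedekind domain, and let $I$ be a nonzero ideal of $R$ which is contained in only finitely many nondivisorial maximal ideals of $R$. Then $I = I^v \cdot \Pi$, where $\Pi$ is a finite product of (not necessarily distinct) maximal ideals of $R$. Thus, if $R$ is an almost Dedekind domain in which each nonzero ideal is contained in only finitely many nondivisorial maximal ideals, then $R$ has the weak factorization property.
   Context: An almost Dedekind domain is an integral domain $R$ such that $R_M$ is a rank one discrete valuation domain for each maximal ideal $M$. For an integral domain $R$ with quotient field $K$ and a nonzero fractional ideal $F$ of $R$, put $F^{-1} = (R:F) = \{x \in K \mid xF \subseteq R\}$ and $F^v = (F^{-1})^{-1}$; a nonzero ideal $F$ is divisorial if $F = F^v$. A Prüfer domain $R$ has the weak factorization property if each nonzero ideal $I$ of $R$ can be written as $I = I^v\Pi$, where $\Pi$ is a finite product of (not necessarily distinct) maximal ideals of $R$. The empty product of maximal ideals is taken to be $R$. *)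

(* Defs.v *)
From HB Require Import structures.
From mathcomp Require Import all_boot all_order all_algebra.
From mathcomp Require Import boolp classical_sets cardinality.

Set Implicit Arguments.
Unset Strict Implicit.
Unset Printing Implicit Defensive.

Import Order.TTheory GRing.Theory Num.Theory.
Local Open Scope classical_set_scope.
Local Open Scope ring_scope.

(* Finite sums of products a * b with a in A and b in B.  It is used both for
   ideals of R (in the ring R) and for R-submodules of the quotient field. *)
Definition mulI (S : comNzRingType) (A B : set S) : set S :=
  [set x | exists (n : nat) (a b : 'I_n -> S),
     [/\ forall i, A (a i), forall i, B (b i) & x = \sum_(i < n) a i * b i]].

Section Ideals.
Variable R : comNzRingType.

(* The unit ideal R is allowed. *)
Definition is_ideal (I : set R) : Prop :=
  [/\ I 0, forall x y, I x -> I y -> I (x + y) & forall r x, I x -> I (r * x)].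

Definition nonzero_ideal (I : set R) : Prop := is_ideal I /\ I <> [set 0].

Definition maximal_ideal (M : set R) : Prop :=
  [/\ is_ideal M, M <> setT &
      forall J, is_ideal J -> M `<=` J -> J = M \/ J = setT].

Definition generated_ideal (n : nat) (a : 'I_n -> R) : set R :=
  [set x | exists c : 'I_n -> R, x = \sum_(i < n) c i * a i].

Definition finitely_generated (I : set R) : Prop :=
  exists (n : nat) (a : 'I_n -> R), I = generated_ideal a.

End Ideals.

Definition discrete_valuation (K : fieldType) (v : K -> int) : Prop :=
  (* The value v 0 plays no role: it stands for +oo. *)
  [/\ forall n : int, exists2 x, x != 0 & v x = n,
      forall x y, x != 0 -> y != 0 -> v (x * y) = v x + v y &
      forall x y, x != 0 -> y != 0 -> x + y != 0 ->
        Num.min (v x) (v y) <= v (x + y)].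

(* V is the valuation ring of a valuation of K with value group Z; in
   particular V is not a field. *)
Definition rank_one_dvr (K : fieldType) (V : set K) : Prop :=
  exists2 v : K -> int, discrete_valuation v &
    V = [set x | x = 0 \/ 0 <= v x].

Section FractionalIdeals.
Variable R : idomainType.
Local Notation K := {fraction R}.

(* A subset of R, viewed in the quotient field of R. *)
Definition inK (A : set R) : set K := (@tofrac R) @` A.

Definition localization (M : set R) : set K :=
  [set x | exists (a s : R), ~ M s /\ x = tofrac a / tofrac s].

Definition almost_dedekind : Prop :=
  forall M : set R, maximal_ideal M -> rank_one_dvr (localization M).

(* (R : F) *)
Definition fracinv (F : set K) : set K :=
  [set x | forall y, F y -> inK setT (x * y)].

Definition vclosure (F : set K) : set K := fracinv (fracinv F).

Definition divisorial (I : set R) : Prop := inK I = vclosure (inK I).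

Definition invertible (I : set R) : Prop :=
  mulI (inK I) (fracinv (inK I)) = inK setT.

Definition prufer : Prop :=
  forall I : set R, nonzero_ideal I -> finitely_generated I -> invertible I.

(* I = I^v P_0 ... P_(n-1) inside the quotient field; for n = 0 the product
   of the P_i is R. *)
Definition weakly_factors (I : set R) : Prop :=
  exists (n : nat) (P : 'I_n -> set R),
    (forall i, maximal_ideal (P i)) /\
    inK I = mulI (vclosure (inK I)) (inK (\big[@mulI R/setT]_(i < n) P i)).

Definition weak_factorization_property : Prop :=
  prufer /\ forall I : set R, nonzero_ideal I -> weakly_factors I.

Definition nondivisorial_maximals_above (I : set R) : set (set R) :=
  [set M | [/\ maximal_ideal M, ~ divisorial M & I `<=` M]].

End FractionalIdeals.

Arguments almost_dedekind R : clear implicits.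
Arguments prufer R : clear implicits.
Arguments weak_factorization_property R : clear implicits.

(* Main.v *)
Require Import Defs.
From mathcomp Require Import all_boot all_order all_algebra.
From mathcomp Require Import zify.
From mathcomp Require Import boolp classical_sets cardinality.

Set Implicit Arguments.
Unset Strict Implicit.
Unset Printing Implicit Defensive.

(** A nonzero ideal of an almost Dedekind domain [R] is determined by its orders at
    the maximal ideals: writing [v M] for the valuation whose ring is the
    localization of [R] at [M], the order of a nonzero ideal [A] at [M] is the
    least value of [v M] on [A], and two ideals with the same order at every
    [M] agree in every localization, hence are equal ([eq_ideal_of_order]).
    Orders add under products of ideals, [M] has order 1 at itself and 0 at
    every other maximal ideal, so a product of maximal ideals can be given any
    prescribed orders at finitely many maximal ideals and order 0 at all
    others.

    It therefore suffices to see that the order of [I] is at least that of its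
    divisorial closure [J], which is clear from the inclusion of [I] in [J],
    and that the two differ at only finitely many [M]; the differences are the
    multiplicities in the product.  If [I] is not contained in [M], both orders
    are 0.  If [M] is divisorial, they agree too ([divisorial_has_order]): the
    inverse of [M] contains some [u] outside [R], necessarily of value -1 at
    [M] and nonnegative value at every other maximal ideal, so that [u ^+ n]
    lies in the inverse of [I] when [n] is the order of [I] at [M]; hence every
    element of [J] times [u ^+ n] is in [R], and [J] has order at least [n].
    Only the nondivisorial maximal ideals containing [I] remain.

    The weak factorization property also asks that [R] be a Prufer domain.  A
    finitely generated ideal is generated in each localization by its element
    of least value, and a common denominator of the finitely many quotients
    shows that its product with its inverse escapes every maximal ideal
    ([almost_dedekind_prufer]). *)

Import Order.TTheory GRing.Theory Num.Theory.

Section Ideals.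
Local Open Scope classical_set_scope.
Local Open Scope ring_scope.

(** * Products of sets *)

Section MulI.
Variable S : comNzRingType.
Implicit Types (A B : set S) (x y c : S).

Lemma mulI_mem A B a b : A a -> B b -> mulI A B (a * b).
Proof.
move=> Aa Bb; exists 1%N, (fun=> a), (fun=> b).
by split=> //; rewrite big_ord1.
Qed.

Lemma mulI0 A B : mulI A B 0.
Proof.
by exists 0%N, (fun=> 0), (fun=> 0); split=> [[]//|[]//|]; rewrite big_ord0.
Qed.

Lemma mulI_add A B x y : mulI A B x -> mulI A B y -> mulI A B (x + y).
Proof.
case=> m [a [b [Aa Bb ->]]] [n [c [d [Ac Bd ->]]]].
exists (m + n)%N,
  (fun i => match split i with inl j => a j | inr j => c j end),
  (fun i => match split i with inl j => b j | inr j => d j end).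
split=> [i|i|]; try by case: (split i).
rewrite big_split_ord /=; congr (_ + _); apply: eq_bigr => i _.
- by rewrite (unsplitK (inl i)).
- by rewrite (unsplitK (inr i)).
Qed.

(** Stability is asked of one scalar [c] at a time so as to cover both ideals of
    a ring and images of ideals in the field of fractions, whose scalars are the
    elements of the ring. *)
Lemma mulI_scale A B c x :
  (forall a, A a -> A (c * a)) -> mulI A B x -> mulI A B (c * x).
Proof.
move=> Ac [n [a [b [Aa Bb ->]]]]; exists n, (fun i => c * a i), b.
split=> [i|//|]; first exact: Ac.
by rewrite mulr_sumr; apply: eq_bigr => i _; rewrite mulrA.
Qed.

Lemma mulI_ideal A B : is_ideal A -> is_ideal (mulI A B).
Proof.
case=> _ _ AM; split; [exact: mulI0 | exact: mulI_add |].
by move=> r x; apply: mulI_scale => a; apply: AM.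
Qed.

End MulI.

(** * Maximal ideals *)

Section Maximal.
Variable R : comNzRingType.
Implicit Types (I J M N : set R) (r s x y : R).

Lemma ideal_setT I : is_ideal I -> I 1 -> I = setT.
Proof.
case=> _ _ IM I1; rewrite eqEsubset; split=> // x _.
by rewrite -(mulr1 x); apply: IM.
Qed.

Lemma colon_ideal I x : is_ideal I -> is_ideal [set r | I (r * x)].
Proof.
case=> I0 ID IM; split=> /= [|a b Ia Ib|r a Ia]; first by rewrite mul0r.
- by rewrite mulrDl; apply: ID.
- by rewrite -mulrA; apply: IM.
Qed.

Lemma maximal_not1 M : maximal_ideal M -> ~ M 1.
Proof. by case=> MI MT _ /(ideal_setT MI). Qed.

Lemma maximal_sub M N : maximal_ideal M -> maximal_ideal N -> M `<=` N -> M = N.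
Proof. by case=> _ _ h [NI NT _] /(h _ NI)[]. Qed.

(** Maximality makes [1 = m + r * s] with [m] in [M], and then
    [t = m * t + r * (s * t)] would be in [M]. *)
Lemma maximal_prime M s t : maximal_ideal M -> ~ M s -> ~ M t -> ~ M (s * t).
Proof.
move=> [[M0 MD MM] _ Mmax] Ms Mt Mst.
pose J := [set x | exists2 m, M m & exists r, x = m + r * s].
have JI : is_ideal J.
  split.
  - by exists 0 => //; exists 0; rewrite mul0r addr0.
  - move=> _ _ [m Mm [r ->]] [n Mn [q ->]]; exists (m + n); first exact: MD.
    by exists (r + q); rewrite mulrDl addrACA.
  - move=> c _ [m Mm [r ->]]; exists (c * m); first exact: MM.
    by exists (c * r); rewrite mulrDr mulrA.
have MJ : M `<=` J by move=> m Mm; exists m => //; exists 0; rewrite mul0r addr0.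
have Js : J s by exists 0 => //; exists 1; rewrite mul1r add0r.
have [JM|JT] := Mmax J JI MJ; first by apply: Ms; rewrite -JM.
have [m Mm [r e]] : J 1 by rewrite JT.
apply: Mt; rewrite -(mul1r t) e mulrDl; apply: MD.
- by rewrite mulrC; apply: MM.
- by rewrite -mulrA; apply: MM.
Qed.

Lemma maximal_prod M n (s : 'I_n -> R) :
  maximal_ideal M -> (forall i, ~ M (s i)) -> ~ M (\prod_(i < n) s i).
Proof.
move=> hM hs; elim/big_ind: _ => //; first exact: maximal_not1.
by move=> x y; apply: maximal_prime.
Qed.

(** Zorn's lemma is applied to the sets [X] for which [I `|` X] is a proper
    ideal rather than to the proper ideals containing [I]: the union of the
    empty chain is then admissible too. *)
Lemma exists_maximal I :
  is_ideal I -> ~ I 1 -> exists2 M, maximal_ideal M & I `<=` M.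
Proof.
move=> hI I1.
pose P (X : set R) := is_ideal (I `|` X) /\ ~ (I `|` X) 1.
have P0 : P set0 by rewrite /P setU0.
have [F FP tF|X [[XI X1] Xmax]] := @Zorn_bigcup R P.
  set U := \bigcup_(X in F) X.
  have one x : (I `|` U) x -> exists2 Z, (F Z \/ Z = set0) & (I `|` Z) x.
    by case=> [Ix|[Z FZ Zx]]; [exists set0; [right|left] | exists Z; [left|right]].
  have sub Z : F Z \/ Z = set0 -> I `|` Z `<=` I `|` U.
    by case=> [FZ|->] x [Ix|Zx]; [left|right; exists Z|left|].
  have PZ Z : F Z \/ Z = set0 -> P Z by case=> [/FP//|->].
  have two x y : (I `|` U) x -> (I `|` U) y ->
      exists2 Z, (F Z \/ Z = set0) & (I `|` Z) x /\ (I `|` Z) y.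
    move=> /one[Z hZ Zx] /one[W hW Wy].
    have [ZW|WZ] : Z `<=` W \/ W `<=` Z.
      case: hZ hW => [FZ [FW|->]|-> _]; [exact: tF | by right | by left].
    - by exists W => //; split=> //; case: Zx => [|/ZW]; [left|right].
    - by exists Z => //; split=> //; case: Wy => [|/WZ]; [left|right].
  split; last by move=> /one[Z /PZ[_]].
  split.
  - by left; case: hI.
  - move=> x y Ux Uy; have [Z hZ [Zx Zy]] := two x y Ux Uy.
    by apply: (sub Z hZ); case: (PZ Z hZ) => [[_ ZD _] _]; apply: ZD.
  - move=> r x /one[Z hZ Zx].
    by apply: (sub Z hZ); case: (PZ Z hZ) => [[_ _ ZM] _]; apply: ZM.
exists (I `|` X); last by left.
split=> // [e|J hJ XJ]; first by apply: X1; rewrite e.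
have [J1|J1] := pselect (J 1); first by right; apply: ideal_setT.
have IJ : I `|` J = J by rewrite setUidr // => x Ix; apply: XJ; left.
left; apply/seteqP; split=> // x Jx; apply: contrapT => nx.
apply: (Xmax J); last by rewrite /P IJ.
split=> [y Xy|e]; last by apply: nx; right; apply: e.
by apply: XJ; right.
Qed.

(** By hypothesis the ideal of all [r] with [r * x] in [I] lies in no maximal
    ideal, so it contains 1. *)
Lemma local_global I x : is_ideal I ->
  (forall M, maximal_ideal M -> exists2 s, ~ M s & I (s * x)) -> I x.
Proof.
move=> hI loc; rewrite -(mul1r x); apply: contrapT => n1.
have [M hM sM] := exists_maximal (colon_ideal x hI) n1.
by have [s Ms /sM] := loc M hM.
Qed.

End Maximal.

(** * Discrete valuations *)

Section Valuation.
Variables (K : fieldType) (v : K -> int).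
Hypothesis hv : discrete_valuation v.

(** The value of 0 is arbitrary, so 0 is admitted separately, standing for an
    element of infinite value. *)
Definition at_least (n : int) (x : K) : Prop := x = 0 \/ n <= v x.

Lemma val_mul x y : x != 0 -> y != 0 -> v (x * y) = v x + v y.
Proof. by case: hv => _ + _; apply. Qed.

Lemma val1 : v 1 = 0.
Proof.
have := @val_mul 1 1 (oner_neq0 _) (oner_neq0 _).
by rewrite mulr1 => /esym/(canRL (addrK _)); rewrite subrr.
Qed.

Lemma val_inv x : x != 0 -> v x^-1 = - v x.
Proof.
move=> x0; apply/eqP; rewrite -addr_eq0; apply/eqP.
by rewrite -val_mul ?invr_eq0 // mulVf // val1.
Qed.

Lemma valX x n : x != 0 -> v (x ^+ n) = v x *+ n.
Proof.
move=> x0; elim: n => [|n IH]; first by rewrite expr0 val1.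
by rewrite exprS mulrS val_mul ?expf_neq0 // IH.
Qed.

Lemma at_leastD n x y : at_least n x -> at_least n y -> at_least n (x + y).
Proof.
case: (eqVneq x 0) => [->|x0]; first by rewrite add0r.
case: (eqVneq y 0) => [->|y0]; first by rewrite addr0.
move=> [/eqP|xn]; first by rewrite (negPf x0).
move=> [/eqP|yn]; first by rewrite (negPf y0).
case: (eqVneq (x + y) 0) => [xy0|xy0]; [by left|right].
case: hv => _ _ /(_ x y x0 y0 xy0); apply: le_trans.
by rewrite le_min xn.
Qed.

Lemma at_leastM m n x y :
  at_least m x -> at_least n y -> at_least (m + n) (x * y).
Proof.
case: (eqVneq x 0) => [->|x0]; first by left; rewrite mul0r.
case: (eqVneq y 0) => [->|y0]; first by left; rewrite mulr0.
move=> [/eqP|xm]; first by rewrite (negPf x0).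
move=> [/eqP|yn]; first by rewrite (negPf y0).
by right; rewrite val_mul // lerD.
Qed.

Lemma at_leastX m x n : at_least m x -> at_least (m *+ n) (x ^+ n).
Proof.
move=> hx; elim: n => [|n IH]; first by right; rewrite expr0 val1 mulr0n.
by rewrite exprS mulrS; apply: at_leastM.
Qed.

End Valuation.

(** * Lists with prescribed multiplicities *)

Lemma exists_seq_count (T : eqType) (s : seq T) (e : T -> nat) :
  exists2 l : seq T, {subset l <= s} &
    forall x, count_mem x l = if x \in s then e x else 0.
Proof.
elim: s => [|y s [l ls lc]]; first by exists [::].
have [ys|ys] := boolP (y \in s).
  exists l => x; first by rewrite inE => /ls->; rewrite orbT.
  by rewrite lc inE; case: eqP => [->|//]; rewrite ys.
exists (nseq (e y) y ++ l) => x.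
  rewrite mem_cat inE mem_nseq => /orP[/andP[_ ->]//|/ls->].
  by rewrite orbT.
rewrite count_cat count_nseq lc inE /= eq_sym; case: eqP => [->|_] /=.
  by rewrite mul1n (negPf ys) addn0.
by rewrite mul0n.
Qed.

(** * Ideals in the field of fractions *)

Section Fractions.
Variable R : idomainType.
Local Notation K := {fraction R}.
Local Notation "x %:F" := (@tofrac R x).
Implicit Types (I J A B M N : set R) (r s a b : R) (x y : K).

Lemma tofrac_neq0 a : a != 0 -> a%:F != 0.
Proof. by rewrite tofrac_eq0. Qed.

Lemma tofrac_sum n (F : 'I_n -> R) : (\sum_(i < n) F i)%:F = \sum_(i < n) (F i)%:F.
Proof. exact: (big_morph _ (@tofracD R) (@tofrac0 R)). Qed.

Lemma tofrac_inj : injective (@tofrac R).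
Proof. by move=> a b /eqP; rewrite tofrac_eq => /eqP. Qed.

Lemma inKP A a : inK A a%:F <-> A a.
Proof. by split=> [[b Ab /tofrac_inj e]|Aa]; [rewrite -e|exists a]. Qed.

Lemma inK_setTD x y : inK [set: R] x -> inK [set: R] y -> inK [set: R] (x + y).
Proof. by move=> [a _ <-] [b _ <-]; exists (a + b) => //; rewrite tofracD. Qed.

Lemma inK_setTM x y : inK [set: R] x -> inK [set: R] y -> inK [set: R] (x * y).
Proof. by move=> [a _ <-] [b _ <-]; exists (a * b) => //; rewrite tofracM. Qed.

Lemma inK_setT_sum n (F : 'I_n -> K) :
  (forall i, inK [set: R] (F i)) -> inK [set: R] (\sum_(i < n) F i).
Proof.
move=> hF; elim/big_ind: _ => //; last exact: inK_setTD.
by exists 0 => //; rewrite tofrac0.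
Qed.

Lemma inK_mulI A B : inK (mulI A B) = mulI (inK A) (inK B).
Proof.
apply/seteqP; split=> [_ [_ [n [a [b [Aa Bb ->]]]] <-]|_ [n [a [b [Aa Bb ->]]]]].
  exists n, (fun i => (a i)%:F), (fun i => (b i)%:F); split=> [i|i|].
  - exact/inKP.
  - exact/inKP.
  - by rewrite tofrac_sum; apply: eq_bigr => i _; rewrite tofracM.
have /choice[a' a'P] i : exists r, A r /\ r%:F = a i.
  by case: (Aa i) => r; exists r.
have /choice[b' b'P] i : exists r, B r /\ r%:F = b i.
  by case: (Bb i) => r; exists r.
exists (\sum_(i < n) a' i * b' i).
  by exists n, a', b'; split=> // i; [case: (a'P i)|case: (b'P i)].
rewrite tofrac_sum; apply: eq_bigr => i _.
by rewrite tofracM; case: (a'P i) => _ ->; case: (b'P i) => _ ->.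
Qed.

Lemma nonzero_ideal_witness I : nonzero_ideal I -> exists2 a, I a & a != 0.
Proof.
move=> [[I0 _ _] hI]; apply: contrapT => h; apply: hI.
apply/seteqP; split=> [a Ia|_ ->//] /=.
by apply/eqP; apply: contrapT => /negP a0; apply: h; exists a.
Qed.

(** The ideal of denominators of [x] lies in no maximal ideal, so it contains
    1. *)
Lemma localization_inter x :
  (forall M, maximal_ideal M -> localization M x) -> inK [set: R] x.
Proof.
move=> loc; pose D := [set r : R | inK [set: R] (r%:F * x)].
suff: D 1 by rewrite /D /= tofrac1 mul1r.
apply: local_global => [|M /loc[a [s [Ms e]]]].
  split=> [|a b|r a]; rewrite /D /=.
  - by rewrite tofrac0 mul0r; exists 0 => //; rewrite tofrac0.
  - by rewrite tofracD mulrDl; apply: inK_setTD.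
  - by rewrite tofracM -mulrA => h; apply: inK_setTM => //; exists r.
exists s => //; rewrite mulr1 /D /= e.
case: (eqVneq s 0) => [->|s0].
  by rewrite tofrac0 mul0r; exists 0 => //; rewrite tofrac0.
by exists a => //; rewrite mulrCA divff ?mulr1 // tofrac_neq0.
Qed.

(** The product of denominators chosen outside [M] stays outside [M], which is
    prime. *)
Lemma common_denominator M n (x : 'I_n -> K) :
  maximal_ideal M -> (forall i, localization M (x i)) ->
  exists2 s, ~ M s & forall i, inK [set: R] (s%:F * x i).
Proof.
move=> hM loc.
have /choice[s sP] (i : 'I_n) : exists s, ~ M s /\ inK [set: R] (s%:F * x i).
  have [a [s [Ms ->]]] := loc i; exists s; split=> //.
  have s0 : s != 0 by apply: contra_notN Ms => /eqP->; case: hM => -[].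
  by exists a => //; rewrite mulrCA divff ?mulr1 // tofrac_neq0.
exists (\prod_(i < n) s i); first by apply: maximal_prod => // i; case: (sP i).
move=> i; rewrite (bigD1 i) //= tofracM mulrAC mulrC.
by apply: inK_setTM; [eexists | case: (sP i)].
Qed.

(** * Divisorial closure *)

(** The divisorial closure as an ideal of [R]; that nothing is lost is
    [inK_videal]. *)
Definition videal I : set R := [set r | vclosure (inK I) r%:F].

Lemma fracinvD (F : set K) x y : fracinv F x -> fracinv F y -> fracinv F (x + y).
Proof. by move=> hx hy z Fz; rewrite mulrDl; apply: inK_setTD; [exact: hx|exact: hy]. Qed.

Lemma fracinvM (F : set K) r x : fracinv F x -> fracinv F (r%:F * x).
Proof. by move=> hx z Fz; rewrite -mulrA; apply: inK_setTM; [exists r|exact: hx]. Qed.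

(** Since 1 is in the inverse of [I], the divisorial closure lies in [R]. *)
Lemma inK_videal I : inK (videal I) = vclosure (inK I).
Proof.
apply/seteqP; split=> [_ [a Ja <-]//|x hx].
have [a _ e] : inK [set: R] x.
  by rewrite -(mulr1 x); apply: hx => y [a _ <-]; rewrite mul1r; exists a.
by exists a; rewrite // /videal /= e.
Qed.

Lemma videal_ideal I : is_ideal (videal I).
Proof.
split=> [|a b Ja Jb|r a Ja]; rewrite /videal /=.
- by rewrite tofrac0 => y _; rewrite mul0r; exists 0 => //; rewrite tofrac0.
- by rewrite tofracD; apply: fracinvD.
- by rewrite tofracM; apply: fracinvM.
Qed.

Lemma sub_videal I : I `<=` videal I.
Proof. by move=> a Ia y hy; rewrite mulrC; apply: hy; exists a. Qed.


(** * Orders of ideals at a maximal ideal *)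

Definition local_valuation M (v : K -> int) : Prop :=
  discrete_valuation v /\ localization M = at_least v 0.

Definition has_order (v : K -> int) A (n : nat) : Prop :=
  (exists a, [/\ A a, a != 0 & v a%:F = n%:Z]) /\
  forall a, A a -> at_least v n%:Z a%:F.

Section OneMaximal.
Variables (M : set R) (v : K -> int).
Hypotheses (hM : maximal_ideal M) (hv : local_valuation M v).

Let dv : discrete_valuation v. Proof. by case: hv. Qed.

Lemma localizationP x : localization M x <-> at_least v 0 x.
Proof. by case: hv => _ ->. Qed.

Lemma at_least_tofrac a : at_least v 0 a%:F.
Proof.
apply/localizationP; exists a, 1; split; first exact: maximal_not1.
by rewrite tofrac1 divr1.
Qed.

Lemma val_ge0 a : a != 0 -> 0 <= v a%:F.
Proof. by case: (at_least_tofrac a) => [/eqP|//]; rewrite tofrac_eq0 => ->. Qed.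

Lemma notin_maximal_neq0 s : ~ M s -> s != 0.
Proof. by apply: contra_notN => /eqP->; case: hM => -[]. Qed.

(** Such an [s] is invertible in the valuation ring. *)
Lemma val_notin s : ~ M s -> v s%:F = 0.
Proof.
move=> Ms; have s0 := notin_maximal_neq0 Ms; apply/eqP.
rewrite eq_le val_ge0 // andbT -oppr_ge0 -val_inv ?tofrac_neq0 //.
have /localizationP[/eqP|//] : localization M (s%:F)^-1.
  by exists 1, s; rewrite tofrac1 div1r.
by rewrite invr_eq0 tofrac_eq0 (negPf s0).
Qed.

(** If [m] had value 0, its inverse would be a fraction [r / s] with [s]
    outside [M], although [s = r * m]. *)
Lemma val_in_gt0 m : M m -> m != 0 -> 0 < v m%:F.
Proof.
move=> Mm m0; rewrite lt_neqAle val_ge0 // andbT; apply/eqP => vm.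
have /localizationP[r [s [Ms e]]] : at_least v 0 (m%:F)^-1.
  by right; rewrite val_inv ?tofrac_neq0 // -vm oppr0.
apply: (Ms); have -> : s = r * m.
  apply: tofrac_inj; rewrite tofracM; apply: (mulIf (x := (m%:F)^-1)).
    by rewrite invr_eq0 tofrac_neq0.
  rewrite -mulrA divff ?tofrac_neq0 // mulr1 e mulrCA divff ?mulr1 //.
  exact/tofrac_neq0/notin_maximal_neq0.
by case: hM => -[_ _ MM] _ _; apply: MM.
Qed.

(** An element of value 1 in the field of fractions is in the valuation ring,
    and multiplying it by its denominator does not change its value. *)
Lemma uniformizer : exists r, [/\ M r, r != 0 & v r%:F = 1].
Proof.
have [x x0 vx] : exists2 x, x != 0 & v x = 1 by case: dv.
have /localizationP[r [s [Ms e]]] : at_least v 0 x by right; rewrite vx.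
have s0 := tofrac_neq0 (notin_maximal_neq0 Ms).
have er : r%:F = x * s%:F by rewrite e divfK.
have vr : v r%:F = 1 by rewrite er (val_mul dv) // vx val_notin.
exists r; split=> //.
- by apply: contrapT => /val_notin; rewrite vr.
- by rewrite -tofrac_eq0 er mulf_neq0.
Qed.

Lemma has_order_uniq A m n : has_order v A m -> has_order v A n -> m = n.
Proof.
have le k l : has_order v A k -> has_order v A l -> (l <= k)%N.
  move=> [[a [Aa a0 va]] _] [_ /(_ a Aa)[/eqP|]]; last by rewrite va.
  by rewrite tofrac_eq0 (negPf a0).
by move=> hm hn; apply/eqP; rewrite eqn_leq !le.
Qed.

Lemma has_order_exists A : nonzero_ideal A -> exists n, has_order v A n.
Proof.
move=> hA.
pose Q n := `[< exists a, [/\ A a, a != 0 & v a%:F = n%:Z] >].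
have Qval a : A a -> a != 0 -> Q `|v a%:F|%N.
  by move=> Aa a0; apply/asboolP; exists a; rewrite gez0_abs ?val_ge0.
have exQ : exists n, Q n.
  by have [a Aa a0] := nonzero_ideal_witness hA; eexists; apply: Qval Aa a0.
case: (ex_minnP exQ) => n /asboolP Qn nmin; exists n; split=> // a Aa.
case: (eqVneq a 0) => [->|a0]; first by left; rewrite tofrac0.
right; rewrite -(gez0_abs (val_ge0 a0)) lez_nat.
exact/nmin/Qval.
Qed.

Lemma has_order0 A a : A a -> ~ M a -> has_order v A 0.
Proof.
move=> Aa Ma; split; last by move=> b _; apply: at_least_tofrac.
by exists a; split; [|exact: notin_maximal_neq0|exact: val_notin].
Qed.

Lemma has_order_mulI A B m n :
  has_order v A m -> has_order v B n -> has_order v (mulI A B) (m + n).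
Proof.
move=> [[a [Aa a0 va]] hA] [[b [Bb b0 vb]] hB]; split.
  exists (a * b); split; [exact: mulI_mem | exact: mulf_neq0 |].
  by rewrite tofracM (val_mul dv) ?tofrac_neq0 // va vb PoszD.
move=> _ [k [c [d [Ac Bd ->]]]]; rewrite tofrac_sum.
elim/big_ind: _ => [|x y|i _]; [by left | exact: at_leastD |].
by rewrite tofracM PoszD; apply: at_leastM; auto.
Qed.

Lemma has_order_maximal : has_order v M 1.
Proof.
split; first by have [r] := uniformizer; exists r.
move=> m Mm; case: (eqVneq m 0) => [->|m0]; first by left; rewrite tofrac0.
by right; rewrite -gtz0_ge1 val_in_gt0.
Qed.

Lemma has_order_maximal_neq N : maximal_ideal N -> M <> N -> has_order v N 0.
Proof.
move=> hN MN; have /existsNP[x /not_implyP[Nx Mx]] : ~ N `<=` M.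
  by move=> NM; apply: MN; rewrite (maximal_sub hN hM NM).
exact: has_order0 Nx Mx.
Qed.

Lemma has_order_prod (l : seq (set R)) :
  (forall N, N \in l -> maximal_ideal N) ->
  has_order v (\big[@mulI R/setT]_(N <- l) N) (count_mem M l).
Proof.
elim: l => [|N l IH] hl.
  by rewrite big_nil; apply: (@has_order0 _ 1) => //; apply: maximal_not1.
rewrite big_cons /=; apply: has_order_mulI; last first.
  by apply: IH => P Pl; apply: hl; rewrite inE Pl orbT.
case: eqP => [->|NM]; first exact: has_order_maximal.
apply: has_order_maximal_neq; last by move=> e; apply: NM.
by apply: hl; rewrite mem_head.
Qed.

(** An element [b] of [B] of least value divides [a] in the localization at
    [M]; clearing the denominator of [a / b] puts a multiple of [a] in [B]. *)
Lemma has_order_mem_local B n a :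
  is_ideal B -> has_order v B n -> at_least v n%:Z a%:F ->
  exists2 s, ~ M s & B (s * a).
Proof.
move=> [_ _ BM] [[b [Bb b0 vb]] _] ha.
have b0K := tofrac_neq0 b0.
have /localizationP[r [s [Ms e]]] : at_least v 0 (a%:F / b%:F).
  rewrite -(subrr n%:Z); apply: at_leastM => //.
  by right; rewrite val_inv // vb.
exists s => //; suff -> : s * a = r * b by apply: BM.
apply: tofrac_inj; rewrite !tofracM -[a%:F](divfK b0K) e mulrA.
by rewrite [s%:F * _]mulrCA divff ?mulr1 // tofrac_neq0 ?notin_maximal_neq0.
Qed.

End OneMaximal.

(** * Almost Dedekind domains *)

Section AlmostDedekind.
Hypothesis hR : almost_dedekind R.

Lemma localization_valuation : exists v : set R -> K -> int,
  forall M, maximal_ideal M -> local_valuation M (v M).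
Proof.
have /choice[v vP] M : exists w, maximal_ideal M -> local_valuation M w.
  have [hM|nM] := pselect (maximal_ideal M); last by exists (fun=> 0).
  by have [w dw e] := hR hM; exists w.
by exists v.
Qed.

(** Let [b] be an element of [I] of least value at [M].  A common denominator
    [s] of the [a i / b] makes [s / b] an element of the inverse of [I], so
    [s = b * (s / b)] is in the product of [I] and its inverse. *)
Lemma almost_dedekind_prufer : prufer R.
Proof.
move=> I hI [n [a eI]]; have [v vP] := localization_valuation.
have II := hI.1.
have Ia i : I (a i).
  rewrite eI; exists (fun j => (j == i)%:R).
  rewrite (bigD1 i) //= eqxx mul1r big1 ?addr0 // => j /negPf->.
  by rewrite mul0r.
apply/seteqP; split=> [_ [m [c [d [Ic Id ->]]]]|_ [r _ <-]].
  by apply: inK_setT_sum => i; rewrite mulrC; apply: Id.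
pose D := [set r | mulI (inK I) (fracinv (inK I)) r%:F].
have scaleI (q : R) y : inK I y -> inK I (q%:F * y).
  by move=> [b Ib <-]; rewrite -tofracM; apply/inKP; case: II => _ _; apply.
have DI : is_ideal D.
  split=> [|p q|p q]; rewrite /D /=.
  - by rewrite tofrac0; apply: mulI0.
  - by rewrite tofracD; apply: mulI_add.
  - by rewrite tofracM; apply: mulI_scale => y; apply: scaleI.
suff D1 : D 1 by rewrite -[r]mulr1; case: DI => _ _; apply.
apply: local_global => // M hM.
have [k [[b [Ib b0 vb]] hk]] := has_order_exists hM (vP M hM) hI.
have b0K := tofrac_neq0 b0.
have [i|s Ms sP] := @common_denominator M n (fun i => (a i)%:F / b%:F) hM.
  apply/(localizationP (vP M hM)); rewrite -(subrr k%:Z).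
  apply: at_leastM; [by case: (vP M hM) | exact: hk |].
  by right; rewrite val_inv ?vb //; case: (vP M hM).
exists s => //; rewrite mulr1 /D /=.
have -> : s%:F = b%:F * (s%:F / b%:F) by rewrite mulrCA divff ?mulr1.
apply: mulI_mem; first exact/inKP.
move=> _ [y Iy <-]; move: Iy; rewrite eI => -[c ->].
rewrite tofrac_sum mulr_sumr; apply: inK_setT_sum => i.
rewrite tofracM mulrCA -mulrA [_^-1 * _]mulrC.
by apply: inK_setTM; [exists (c i)|].
Qed.

Variable v : set R -> K -> int.
Hypothesis vP : forall M, maximal_ideal M -> local_valuation M (v M).

(** Equal orders make [a] in [A] a multiple of an element of [B] in each
    localization, and membership in [B] is local. *)
Lemma sub_ideal_of_order A B :
  is_ideal B ->
  (forall M, maximal_ideal M ->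
     exists2 n, has_order (v M) A n & has_order (v M) B n) -> A `<=` B.
Proof.
move=> hB h a Aa; apply: local_global => // M hM.
have [n [_ hA] hBn] := h M hM.
exact: (has_order_mem_local hM (vP hM) hB hBn (hA a Aa)).
Qed.

Lemma eq_ideal_of_order A B :
  is_ideal A -> is_ideal B ->
  (forall M, maximal_ideal M ->
     exists2 n, has_order (v M) A n & has_order (v M) B n) -> A = B.
Proof.
move=> hA hB h; apply/seteqP; split; apply: sub_ideal_of_order => // M hM.
by have [n hAn hBn] := h M hM; exists n.
Qed.

(** If the inverse of [M] were contained in [R], then 1 would be in the
    divisorial closure of [M], which is [M].  So there is [u] outside [R] with
    [u M] inside [R].  At another maximal ideal [N], some element of [M] is a
    unit, so [u] has nonnegative value; as [u] is not in [R], its value at [M]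
    is negative, and it is at least -1 because [M] contains an element of
    value 1. *)
Lemma divisorial_inverse M : maximal_ideal M -> divisorial M ->
  exists2 u, (forall N, maximal_ideal N -> M <> N -> at_least (v N) 0 u) &
    u != 0 /\ v M u = -1.
Proof.
move=> hM dM.
have /existsNP[u /not_implyP[uM uR]] : ~ fracinv (inK M) `<=` inK [set: R].
  move=> h; apply: (maximal_not1 hM); apply/inKP; rewrite dM tofrac1.
  by move=> y /h; rewrite mul1r.
(* Some [x] in [M] is a unit at [N], and [u * x] is in [R]. *)
have loc N : maximal_ideal N -> M <> N -> at_least (v N) 0 u.
  move=> hN MN; have hvN := vP hN.
  have [[x [Mx x0 vx]] _] := has_order_maximal_neq hN hvN hM (nesym MN).
  have [a _ e] : inK [set: R] (u * x%:F) by apply: uM; apply/inKP.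
  have -> : u = a%:F * (x%:F)^-1 by rewrite e mulfK ?tofrac_neq0.
  rewrite -(addr0 0); apply: at_leastM; first by case: hvN.
    exact: (at_least_tofrac hN hvN).
  by right; rewrite val_inv ?tofrac_neq0 ?vx ?oppr0 //; case: hvN.
exists u => //; have u0 : u != 0.
  by apply: contra_notN uR => /eqP->; exists 0 => //; rewrite tofrac0.
split=> //; have [r [Mr r0 vr]] := uniformizer hM (vP hM).
have dv : discrete_valuation (v M) by case: (vP hM).
apply/eqP; rewrite eq_le; apply/andP; split.
  rewrite leNgt; apply/negP => vu; apply: uR; apply: localization_inter => N hN.
  apply/(localizationP (vP hN)).
  have [<-|/loc] := pselect (M = N); last exact.
  by right; lia.
have [a _ e] : inK [set: R] (u * r%:F) by apply: uM; apply/inKP.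
have a0 : a != 0 by rewrite -tofrac_eq0 e mulf_neq0 ?tofrac_neq0.
have := val_ge0 hM (vP hM) a0.
by rewrite e (val_mul dv) ?tofrac_neq0 // vr; lia.
Qed.

(** With [u] from [divisorial_inverse], the power [u ^+ n] multiplies [I] into
    every localization, so it lies in the inverse of [I]; it then multiplies the
    divisorial closure into [R], which bounds values there below by [n]. *)
Lemma divisorial_has_order M I n : maximal_ideal M -> divisorial M ->
  has_order (v M) I n -> has_order (v M) (videal I) n.
Proof.
move=> hM dM [[a [Ia a0 va]] hI].
split; first by exists a; split=> //; apply: sub_videal.
have [u uN [u0 vu]] := divisorial_inverse hM dM.
have dv N : maximal_ideal N -> discrete_valuation (v N) by case/vP.
have un0 : u ^+ n != 0 by rewrite expf_neq0.
have uI : fracinv (inK I) (u ^+ n).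
  move=> _ [x Ix <-]; apply: localization_inter => N hN.
  apply/(localizationP (vP hN)).
  have [<-|MN] := pselect (M = N).
    rewrite -(subrr n%:Z) addrC; apply: at_leastM; [exact: dv| |exact: hI].
    by right; rewrite (valX (dv M hM)) // vu mulNrn natz.
  rewrite -(addr0 0); apply: at_leastM; first exact: dv.
    by rewrite -(mul0rn _ n); apply: at_leastX; [exact: dv|exact: uN].
  exact: (at_least_tofrac hN (vP hN)).
move=> j Jj.
have [c _ e] := Jj _ uI.
have -> : j%:F = c%:F * (u ^+ n)^-1 by rewrite e mulfK.
rewrite -(add0r n%:Z); apply: at_leastM; [exact: dv|exact: (at_least_tofrac hM (vP hM))|].
right; rewrite val_inv //; last exact: dv.
by rewrite (valX (dv M hM)) // vu mulNrn opprK natz.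
Qed.

End AlmostDedekind.

(** The multiplicity [e M] is the excess of the order of [I] over that of its
    divisorial closure; only its values on the finite list [s] of nondivisorial
    maximal ideals above [I] enter the product, and away from [s] the excess
    vanishes. *)
Lemma almost_dedekind_weakly_factors I : almost_dedekind R -> nonzero_ideal I ->
  finite_set (nondivisorial_maximals_above I) -> weakly_factors I.
Proof.
move=> hR hI /finite_seqP[s hs].
have [v vP] := localization_valuation hR.
have JI : is_ideal (videal I) by apply: videal_ideal.
have hJ : nonzero_ideal (videal I).
  split=> // J0; have [a Ia /eqP a0] := nonzero_ideal_witness hI.
  by apply: a0; have := sub_videal Ia; rewrite J0.
have /choice[e eP] M : exists e, maximal_ideal M ->
    exists2 m, has_order (v M) (videal I) m & has_order (v M) I (m + e).
  have [hM|nM] := pselect (maximal_ideal M); last by exists 0%N.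
  have [n hn] := has_order_exists hM (vP M hM) hI.
  have [m hm] := has_order_exists hM (vP M hM) hJ.
  exists (n - m)%N => _; exists m => //; rewrite subnKC //.
  have [[a [/sub_videal Ja a0 va]] _] := hn.
  have [_ /(_ a Ja)[/eqP|]] := hm; last by rewrite va.
  by rewrite tofrac_eq0 (negPf a0).
have [l ls lc] := exists_seq_count s e.
have lmax N : N \in l -> maximal_ideal N.
  move=> /ls Ns; have : [set` s] N by [].
  by rewrite -hs => -[].
exists (size l), (tnth (in_tuple l)); split.
  by move=> i; apply: lmax; apply: mem_tnth.
rewrite -(big_tnth _ _ _ xpredT id) -inK_videal -inK_mulI; congr inK.
apply: (eq_ideal_of_order vP); [exact: hI.1 | exact: mulI_ideal |].
move=> M hM; have [m hm hme] := eP M hM.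
exists (m + e M)%N => //.
suff -> : e M = count_mem M l.
  apply: (has_order_mulI (vP M hM) hm).
  exact: (has_order_prod hM (vP M hM) lmax).
rewrite lc; case: ifP => // /negP Ms.
have nMs : ~ nondivisorial_maximals_above I M by rewrite hs.
(* Off [s], the closure has the same order [m + e M] as [I]; as its order is
   also [m], this forces [e M = 0]. *)
have hme0 : has_order (v M) (videal I) (m + e M).
  have [dM|ndM] := pselect (divisorial M); first exact: divisorial_has_order.
  have /existsNP[x /not_implyP[Ix Mx]] : ~ I `<=` M by move=> IM; apply: nMs.
  have e0 := has_order_uniq hme (has_order0 hM (vP M hM) Ix Mx).
  by rewrite e0; apply: has_order0 Mx => //; [exact: vP|exact: sub_videal].
by have := has_order_uniq hm hme0; lia.
Qed.

End Fractions.
End Ideals.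

Theorem theorem1p15 (R : idomainType) (hR : almost_dedekind R) :
  (forall I : set R, nonzero_ideal I ->
     finite_set (nondivisorial_maximals_above I) -> weakly_factors I) /\
  ((forall I : set R, nonzero_ideal I ->
      finite_set (nondivisorial_maximals_above I)) ->
   weak_factorization_property R).
Proof.
have factors I := @almost_dedekind_weakly_factors R I hR.
split=> [I|fin]; first exact: factors.
split; first exact: almost_dedekind_prufer.
by move=> I hI; apply: factors => //; apply: fin.
Qed.
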